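(* As $n\to+\infty$, $$\log k(n)\leqslant\left(\frac{1}{\sqrt2}+o(1)\right)\sqrt{\log n\,\log\log n}.$$
   Context: For $n\ge1$ let $t(n)$ be the rooted planar tree of $n$: $t(1)$ is the single-vertex tree; if $n=p_1^{a_1}\cdots p_s^{a_s}$ with primes $p_1<\dots<p_s$, $a_i\ge1$, then $t(n)$ is a root with $s$ ordered edges, the $i$-th leading to a copy of $t(a_i)$. Let $t^\#(n)$ be the corresponding nonplanar rooted tree (forgetting the order of children). For $n\ge1$, $k(n)=\max\{k\ge1: t^\#(n+1)=t^\#(n+2)=\cdots=t^\#(n+k)\}$. *)

(* Defs.v *)
From HB Require Import structures.
From mathcomp Require Import all_boot generic_quotient boolp.

Local Open Scope quotient_scope.

Set Implicit Arguments.
Unset Strict Implicit.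
Unset Printing Implicit Defensive.

Inductive ptree : Type := Node of seq ptree.

Definition children (x : ptree) : seq ptree := let: Node s := x in s.

HB.instance Definition _ := gen_eqMixin ptree.
HB.instance Definition _ := gen_choiceMixin ptree.

Definition leaf : ptree := Node [::].

(* Structural recursion is not available since the recursive calls are on
   exponents; fuel [m >= n] suffices because an exponent in the factorization
   of [n] is [< n] (see [ptree_ofE]). *)
Fixpoint ptree_of_rec (m n : nat) : ptree :=
  if m is m'.+1 then
    Node [seq ptree_of_rec m' pa.2 | pa <- prime_decomp n]
  else leaf.

Definition ptree_of (n : nat) : ptree := ptree_of_rec n n.

Lemma exponent_bounds (n : nat) (pa : nat * nat) :
  pa \in prime_decomp n -> 0 < pa.2 < n.
Proof.
case: n pa => [|n] [p a] // /mem_prime_decomp [p_pr a_gt0 dvd_n] /=.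
rewrite a_gt0 /=.
exact: leq_trans (ltn_expl a (prime_gt1 p_pr)) (dvdn_leq (ltn0Sn n) dvd_n).
Qed.

Lemma ptree_of_rec_fuel (m n : nat) : n <= m -> ptree_of_rec m n = ptree_of n.
Proof.
rewrite /ptree_of; elim/ltn_ind: m n => -[|m] IH [|n] //= le_nm.
congr Node; apply/eq_in_map => pa /exponent_bounds /andP[_]; rewrite ltnS => le_a.
by rewrite !IH // (leq_trans le_a).
Qed.

Lemma ptree_ofE (n : nat) :
  ptree_of n = Node [seq ptree_of pa.2 | pa <- prime_decomp n].
Proof.
case: n => [|n] //; rewrite {1}/ptree_of /=.
congr Node; apply/eq_in_map => pa /exponent_bounds /andP[_]; rewrite ltnS.
exact: ptree_of_rec_fuel.
Qed.

(* Isomorphism of rooted trees, ignoring the order of children. *)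
Inductive ptree_iso : ptree -> ptree -> Prop :=
  PtreeIso (s t : seq ptree) (f : 'I_(size s) -> 'I_(size t)) :
    bijective f ->
    (forall i : 'I_(size s), ptree_iso (nth leaf s i) (nth leaf t (f i))) ->
    ptree_iso (Node s) (Node t).

Lemma leaf_iso_refl : ptree_iso leaf leaf.
Proof. by apply: (@PtreeIso [::] [::] id) => [|[]//]; exists id. Qed.

Lemma ptree_iso_refl (x : ptree) : ptree_iso x x.
Proof.
move: x; fix IH 1 => -[s].
have H : forall j, ptree_iso (nth leaf s j) (nth leaf s j).
  elim: s => [|x s IHs] j; first by rewrite nth_nil; exact: leaf_iso_refl.
  by case: j => [|j] /=; [exact: (IH x) | exact: (IHs j)].
clear IH; apply: (@PtreeIso s s id) => [|i]; [by exists id | exact: H].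
Qed.

Lemma ptree_iso_sym (x y : ptree) : ptree_iso x y -> ptree_iso y x.
Proof.
elim=> s t f [g fK gK] _ IH; apply: (@PtreeIso t s g); first by exists f.
by move=> i; rewrite -{1}(gK i).
Qed.

Lemma ptree_iso_inv (x y : ptree) : ptree_iso x y ->
  exists2 f : 'I_(size (children x)) -> 'I_(size (children y)), bijective f &
    forall i : 'I_(size (children x)),
      ptree_iso (nth leaf (children x) i) (nth leaf (children y) (f i)).
Proof. by case=> s t f bij_f st; exists f. Qed.

Lemma ptree_iso_trans (x y z : ptree) :
  ptree_iso x y -> ptree_iso y z -> ptree_iso x z.
Proof.
move=> xy; elim: xy z => s t f bij_f _ IH z yz.
case: z yz => u /ptree_iso_inv /= [g bij_g tu].
apply: (@PtreeIso s u (g \o f)); first exact: bij_comp.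
by move=> i; apply: IH; exact: tu.
Qed.

Definition ptree_isob (x y : ptree) : bool := `[< ptree_iso x y >].

Lemma ptree_isob_refl : reflexive ptree_isob.
Proof. by move=> x; apply/asboolP; exact: ptree_iso_refl. Qed.

Lemma ptree_isob_sym : symmetric ptree_isob.
Proof.
by move=> x y; apply/asboolP/asboolP; exact: ptree_iso_sym.
Qed.

Lemma ptree_isob_trans : transitive ptree_isob.
Proof.
by move=> y x z /asboolP xy /asboolP yz; apply/asboolP/(ptree_iso_trans xy).
Qed.

Canonical ptree_equiv : equiv_rel ptree :=
  EquivRel ptree_isob ptree_isob_refl ptree_isob_sym ptree_isob_trans.

Definition nptree : Type := {eq_quot ptree_equiv}.
HB.instance Definition _ := Choice.on nptree.

Definition nptree_of (n : nat) : nptree :=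
  \pi_({eq_quot ptree_equiv}) (ptree_of n).

Lemma nptree_ofP (m n : nat) :
  nptree_of m = nptree_of n <-> ptree_iso (ptree_of m) (ptree_of n).
Proof.
split; last by move=> /asboolP mn; apply/eqmodP.
by move=> /eqmodP /asboolP.
Qed.

Lemma nptree_of_omega (m n : nat) :
  nptree_of m = nptree_of n -> size (primes m) = size (primes n).
Proof.
move=> /nptree_ofP; rewrite !ptree_ofE => mn.
suff H (x y : ptree) : ptree_iso x y -> size (children x) = size (children y).
  by have := H _ _ mn; rewrite /= !size_map.
by case=> s t f /bij_eq_card; rewrite !card_ord.
Qed.

Definition const_run (n k : nat) : bool :=
  (0 < k) && [forall i : 'I_k, nptree_of (n + i.+1) == nptree_of (n + 1)].

Lemma const_run_exists (n : nat) : exists k, const_run n k.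
Proof. by exists 1; apply/andP; split=> //; apply/forallP=> i; rewrite ord1. Qed.

(* Only finiteness matters here: a longer run would contain both [2 ^ n.+1] and
   [3 * 2 ^ n.+1], which have one and two prime factors. *)
Lemma const_run_bounded (n k : nat) : const_run n k -> k <= 3 * 2 ^ n.+1.
Proof.
move=> /andP[_ /forallP run]; rewrite leqNgt; apply/negP => lt_k.
have in_run m : n < m <= 3 * 2 ^ n.+1 -> nptree_of m = nptree_of (n + 1).
  move=> /andP[lt_nm le_m].
  have lt_i : m - n.+1 < k by rewrite (leq_ltn_trans _ lt_k)// (leq_trans (leq_subr _ _)).
  by have /eqP := run (Ordinal lt_i); rewrite /= -addSnnS subnKC.
have lt2 : n < 2 ^ n.+1 by rewrite (ltn_trans (ltnSn n))// ltn_expl.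
have E1 : nptree_of (2 ^ n.+1) = nptree_of (n + 1).
  by apply: in_run; rewrite lt2 leq_pmull.
have E2 : nptree_of (3 * 2 ^ n.+1) = nptree_of (n + 1).
  by apply: in_run; rewrite leqnn andbT (leq_trans lt2) ?leq_pmull.
have := nptree_of_omega (etrans E1 (esym E2)).
rewrite (_ : primes (3 * 2 ^ n.+1) = [:: 2; 3]); first by rewrite primesX.
apply: (irr_sorted_eq ltn_trans ltnn (sorted_primes _)) => // p.
by rewrite primesM ?expn_gt0// primesX// !primes_prime// !inE orbC.
Qed.

Definition run_length (n : nat) : nat :=
  ex_maxn (const_run_exists n) (@const_run_bounded n).

(* Main.v *)
Require Import Defs.
From mathcomp Require Import all_boot all_order all_algebra.
From mathcomp Require Import all_classical all_reals all_analysis.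
From mathcomp Require Import zify ring lra.

Set Implicit Arguments.
Unset Strict Implicit.
Unset Printing Implicit Defensive.

Import Order.TTheory GRing.Theory Num.Theory.
Import numFieldNormedType.Exports.
Local Open Scope classical_set_scope.

(* All integers of a run of length k have the same number of prime factors, and
   this is the only consequence of the equality of the trees that is needed.
   Some member of the run is a multiple of a product of about log k / loglog k
   distinct primes of size (log k)^(1 + o(1)); such primes exist by Chebyshev's
   lower bound for pi(x).  On average, however, a member has only
   o(log k / loglog k) prime factors at most k: the average over the run is at
   most twice the average over [1, k], where primes >= 2^s occur at most
   log2 k / s times and primes < 2^s contribute at most s.  Hence some member has
   about log k / loglog k prime factors exceeding k, so that
   log n >= (1 - o(1)) (log k)^2 / loglog k.  As loglog n >= (2 - o(1)) loglog k,
   log n loglog n >= (2 - o(1)) (log k)^2. *)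

Local Open Scope nat_scope.

(** * Chebyshev's lower bound for the prime counting function *)

Definition prime_pi (x : nat) : nat := count prime (iota 0 x.+1).

Lemma central_bin_ge (n : nat) : 2 ^ n <= 'C(n.*2, n).
Proof.
elim: n => // n IHn; rewrite doubleS expnS binS.
have -> : 'C(n.*2.+1, n.+1) = 'C(n.*2.+1, n).
  by rewrite -bin_sub; [congr 'C(_, _); lia | lia].
rewrite addnn -mul2n leq_mul2l /= (leq_trans IHn) //.
by case: n {IHn} => // n; rewrite binS leq_addr.
Qed.

(** By Legendre's formula each [p ^ k] contributes [n.*2 %/ p ^ k] minus twice [n %/ p ^ k], which
    is at most 1, and 0 once [p ^ k > n.*2]. *)
Lemma logn_central_bin (p n : nat) : prime p ->
  logn p 'C(n.*2, n) <= trunc_log p n.*2.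
Proof.
move=> p_pr; have p_gt1 := prime_gt1 p_pr.
have := bin_fact (leq_addl n n); rewrite addnK addnn => def_fact.
have := congr1 (logn p) def_fact.
rewrite !lognM ?muln_gt0 ?fact_gt0 ?bin_gt0 -?addnn ?leq_addl // addnn.
rewrite !logn_fact // => def_log.
have widen : \sum_(1 <= k < n.+1) n %/ p ^ k = \sum_(1 <= k < n.*2.+1) n %/ p ^ k.
  rewrite [RHS](big_cat_nat (n := n.+1)) //=; last lia.
  rewrite [X in _ = _ + X]big_nat_cond [X in _ = _ + X]big1 ?addn0 // => k.
  by move=> /andP[/andP[lt_nk _] _]; rewrite divn_small // (ltn_trans lt_nk) // ltn_expl.
rewrite widen in def_log.
suff : \sum_(1 <= k < n.*2.+1) n.*2 %/ p ^ k <=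
    \sum_(1 <= k < n.*2.+1) n %/ p ^ k + \sum_(1 <= k < n.*2.+1) n %/ p ^ k
    + trunc_log p n.*2 by lia.
(* Written as a sum of indicators, the logarithm can be compared with the Legendre sums term by
   term. *)
have -> : trunc_log p n.*2 = \sum_(1 <= k < n.*2.+1) (k <= trunc_log p n.*2).
  have le_log : trunc_log p n.*2 <= n.*2.
    case: (posnP n.*2) => [->|n_gt0]; first by rewrite trunc_log0.
    by rewrite (leq_trans (ltnW (ltn_expl _ p_gt1))) // trunc_logP.
  rewrite (big_cat_nat (n := (trunc_log p n.*2).+1)) //=.
  rewrite [X in _ = X + _]big_nat_cond [X in _ = X + _](eq_bigr (fun=> 1)).
    rewrite -big_nat_cond sum_nat_const_nat muln1 subn1 /=.
    rewrite big_nat_cond big1 ?addn0 // => k /andP[/andP[lt_k _] _].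
    by rewrite leqNgt lt_k.
  by move=> k /andP[/andP[_]]; rewrite ltnS => ->.
rewrite -!big_split /=; apply: leq_sum => k _.
case: (leqP k (trunc_log p n.*2)) => [_|lt_k].
  by rewrite -addnn divnD ?leq_add2l ?leq_b1 // expn_gt0 prime_gt0.
rewrite divn_small // (leq_trans (trunc_log_ltn _ p_gt1)) //.
by rewrite leq_exp2l.
Qed.

Lemma prod_primes_logn (n : nat) : 0 < n -> n = \prod_(p <- primes n) p ^ logn p n.
Proof. by move=> n_gt0; rewrite {1}(prod_prime_decomp n_gt0) prime_decompE big_map. Qed.

Lemma prime_le_central_bin (p n : nat) : p \in primes 'C(n.*2, n) -> p <= n.*2.
Proof.
rewrite mem_primes => /and3P[p_pr b_gt0 p_dvd].
have : 0 < logn p 'C(n.*2, n) by rewrite logn_gt0 mem_primes p_pr b_gt0.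
move=> /leq_trans/(_ (logn_central_bin n p_pr)).
by rewrite trunc_log_gt0 => /andP[_]; case: p {p_pr p_dvd}.
Qed.

(** For [n = 2 ^ h] every prime power in ['C(n.*2, n)] is at most [n.*2], so [2 ^ n] is at most
    [n.*2] to the power [prime_pi n.*2]; the claim compares exponents of 2. *)
Lemma prime_pi_ge (h : nat) : 2 ^ h <= h.+1 * prime_pi (2 ^ h.+1).
Proof.
set n := 2 ^ h; have def_n : 2 ^ h.+1 = n.*2 by rewrite expnS mul2n.
have n_gt0 : 0 < n.*2 by rewrite -def_n expn_gt0.
rewrite -(@leq_exp2l 2) // expnM def_n.
apply: leq_trans (central_bin_ge n) _.
have b_gt0 : 0 < 'C(n.*2, n) by rewrite bin_gt0 -addnn leq_addr.
rewrite [X in X <= _](prod_primes_logn b_gt0).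
apply: (@leq_trans (\prod_(p <- primes 'C(n.*2, n)) n.*2)).
  rewrite !big_seq; apply: leq_prod => p.
  rewrite mem_primes => /and3P[p_pr _ _].
  by rewrite (leq_trans (leq_pexp2l (prime_gt0 p_pr) (logn_central_bin n p_pr)))
     ?trunc_logP ?prime_gt1.
rewrite big_const_seq iter_muln_1 count_predT leq_pexp2l //.
rewrite /prime_pi -size_filter uniq_leq_size ?primes_uniq // => p p_in.
rewrite mem_filter mem_iota ltnS /= (prime_le_central_bin p_in) andbT.
by move: p_in; rewrite mem_primes => /and3P[].
Qed.

(** * Small prime factors are rare on average *)

Lemma expn_count_primes (a m : nat) : 0 < m -> a ^ count (leq a) (primes m) <= m.
Proof.
move=> m_gt0; rewrite [X in _ <= X](prod_primes_logn m_gt0).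
rewrite -sum1_count (big_morph (expn a) (expnD a) (expn0 a)) big_mkcond !big_seq.
apply: leq_prod => p p_in /=.
have [p_pr _ _] : [/\ prime p, 0 < m & p %| m] by apply/and3P; rewrite -mem_primes.
have p_gt0 := prime_gt0 p_pr.
case: ifP => [le_ap|_]; last by rewrite expn_gt0 p_gt0.
rewrite expn1 (leq_trans le_ap) // -[X in X <= _]expn1 leq_pexp2l //.
by rewrite logn_gt0.
Qed.

(** Puts the count in a form where sums over [m] and over [p] can be exchanged. *)
Lemma count_primes_range (a b m : nat) : 0 < m ->
  count (fun p => a <= p < b) (primes m) =
  \sum_(a <= p < b | prime p) (p %| m).
Proof.
move=> m_gt0.
rewrite -big_mkcondr /= sum1_count -!size_filter; apply/perm_size/uniq_perm.
- by rewrite filter_uniq ?primes_uniq.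
- by rewrite filter_uniq ?iota_uniq.
move=> p; rewrite !mem_filter mem_primes m_gt0 mem_index_iota /=.
by rewrite andbC.
Qed.

Lemma count_multiples_interval (n k p : nat) :
  \sum_(n.+1 <= m < (n + k).+1) (p %| m) <= (k %/ p).+1.
Proof.
have := divn_count_dvd p (n + k).
rewrite (big_cat_nat (n := n.+1)) //=; last by rewrite ltnS leq_addr.
rewrite -divn_count_dvd; case: (posnP p) => [->|p_gt0].
  by rewrite !divn0 add0n => <-.
by rewrite divnD //; case: (_ <= _); lia.
Qed.

(** A crude harmonic bound: each of the [s] dyadic blocks contributes at most [k]. *)
Lemma sum_divn_dyadic (k s : nat) : \sum_(1 <= d < 2 ^ s) k %/ d <= s * k.
Proof.
elim: s => [|s IHs]; first by rewrite big_geq.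
have e0 : 0 < 2 ^ s by rewrite expn_gt0.
rewrite (big_cat_nat (n := (2 ^ s))) //=; last by rewrite expnS; lia.
rewrite mulSn addnC leq_add //.
apply: (@leq_trans (\sum_(2 ^ s <= d < 2 ^ s.+1) k %/ 2 ^ s)).
  rewrite big_nat_cond [X in _ <= X]big_nat_cond; apply: leq_sum => d.
  by move=> /andP[/andP[le_d _] _]; apply: leq_div2l.
rewrite sum_nat_const_nat expnS mul2n -addnn addnK mulnC.
exact: leq_divM.
Qed.

Lemma sum_divn_primes_le (k s j : nat) : 0 < s -> 2 ^ s <= k.+1 -> k < 2 ^ j.+1 ->
  \sum_(1 <= p < k.+1 | prime p) k %/ p <= (j %/ s + s) * k.
Proof.
move=> s_gt0 le_sk lt_kj.
have e0 : 0 < 2 ^ s by rewrite expn_gt0.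
rewrite (big_cat_nat (n := (2 ^ s))) //= mulnDl addnC leq_add //; last first.
  apply: leq_trans (sum_divn_dyadic k s).
  by rewrite big_mkcond; apply: leq_sum => d _; case: ifP.
(* After the exchange, each [m <= k] counts its prime factors at least [2 ^ s]; if there are [c] of
   them, [2 ^ (c * s) <= m < 2 ^ j.+1] forces [c <= j %/ s]. *)
under eq_bigr do rewrite divn_count_dvd.
rewrite exchange_big /=.
apply: (@leq_trans (\sum_(1 <= m < k.+1) j %/ s)); last first.
  by rewrite sum_nat_const_nat subn1 mulnC.
rewrite big_nat_cond [X in _ <= X]big_nat_cond; apply: leq_sum => m.
move=> /andP[/andP[m_gt0 lt_mk] _].
rewrite -count_primes_range // leq_divRL //.
set c := count _ _.
have le_c : c <= count (leq (2 ^ s)) (primes m).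
  by apply: sub_count => p /= /andP[].
have : 2 ^ (c * s) <= m.
  rewrite mulnC expnM; apply: leq_trans (expn_count_primes (2 ^ s) m_gt0).
  by rewrite leq_pexp2l.
move=> le_m; rewrite -ltnS -(@ltn_exp2l 2) //.
by apply: leq_ltn_trans le_m _; apply: leq_trans lt_kj.
Qed.

(** Averaging over the run. The doubling pays for the extra multiple of [p] an interval may contain:
    [(k %/ p).+1 <= (k %/ p).*2] for [1 <= p <= k]. *)
Lemma exists_few_small_primes (n k s j : nat) :
  0 < s -> 0 < k -> 2 ^ s <= k.+1 -> k < 2 ^ j.+1 ->
  exists2 m, n < m <= n + k &
    count (fun p => 1 <= p < k.+1) (primes m) <= (j %/ s + s).*2.
Proof.
move=> s_gt0 k_gt0 le_sk lt_kj; set e := (_ + s).*2.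
have sum_le : \sum_(n.+1 <= m < (n + k).+1)
    count (fun p => 1 <= p < k.+1) (primes m) <= e * k.
  rewrite (eq_big_nat _ _
    (F2 := fun m => \sum_(1 <= p < k.+1 | prime p) (p %| m))); last first.
    by move=> m /andP[lt_nm _]; apply: count_primes_range; apply: leq_trans lt_nm.
  rewrite exchange_big /=.
  apply: (@leq_trans (\sum_(1 <= p < k.+1 | prime p) (k %/ p).*2)).
    rewrite big_nat_cond [X in _ <= X]big_nat_cond; apply: leq_sum => p.
    move=> /andP[/andP[p_gt0 le_pk] _].
    apply: leq_trans (count_multiples_interval n k p) _.
    by rewrite -addnn -addn1 leq_add2l divn_gt0.
  rewrite (eq_bigr (fun p => 2 * (k %/ p))); last by move=> p _; rewrite mul2n.
  by rewrite -big_distrr /= /e -mul2n -mulnA leq_mul2l /= sum_divn_primes_le.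
case: (boolP (has (fun m => count (fun p => 1 <= p < k.+1) (primes m) <= e)
  (index_iota n.+1 (n + k).+1))) => [/hasP[m]|/hasPn no_m].
  by rewrite mem_index_iota ltnS; exists m.
suff : e.+1 * k <= e * k by rewrite leq_pmul2r // ltnn.
apply: leq_trans sum_le.
have -> : e.+1 * k = \sum_(n.+1 <= m < (n + k).+1) e.+1.
  by rewrite sum_nat_const_nat subSS addKn mulnC.
rewrite !big_seq; apply: leq_sum => m m_in.
by rewrite ltnNge; exact: no_m.
Qed.

(** * A member with many prime factors *)

Lemma exists_multiple (n k d : nat) : 0 < d <= k ->
  exists2 m, n < m <= n + k & d %| m.
Proof.
move=> /andP[d_gt0 le_dk]; exists (d * (n %/ d).+1); last exact: dvdn_mulr.
rewrite mulnC ltn_ceil //= mulSn addnC leq_add //; exact: leq_divM.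
Qed.

(** Chebyshev's bound and [j <= 2 ^ h] provide [j %/ h.+1] primes up to [2 ^ h.+1]; their product is
    at most [2 ^ j <= k], so it divides a member of the interval. *)
Lemma exists_many_primes (n k j h : nat) : 2 ^ j <= k -> j <= 2 ^ h ->
  exists2 m, n < m <= n + k & j %/ h.+1 <= size (primes m).
Proof.
move=> le_jk le_jh; set r := j %/ h.+1.
pose ps := take r [seq p <- iota 0 (2 ^ h.+1).+1 | prime p].
have size_ps : size ps = r.
  rewrite size_takel // size_filter -/(prime_pi _).
  rewrite -(@leq_pmul2l h.+1) //; apply: leq_trans (prime_pi_ge h).
  by rewrite (leq_trans _ le_jh) // mulnC leq_divM.
have ps_uniq : uniq ps by rewrite take_uniq // filter_uniq ?iota_uniq.
have ps_in p : p \in ps -> prime p && (p <= 2 ^ h.+1).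
  by move=> /mem_take; rewrite mem_filter mem_iota ltnS.
have P_gt0 : 0 < \prod_(p <- ps) p.
  by rewrite big_seq prodn_cond_gt0 // => p /ps_in /andP[/prime_gt0].
have P_le : \prod_(p <- ps) p <= k.
  apply: leq_trans le_jk.
  apply: (@leq_trans (\prod_(p <- ps) 2 ^ h.+1)).
    by rewrite !big_seq; apply: leq_prod => p /ps_in /andP[].
  rewrite big_const_seq iter_muln_1 count_predT size_ps -expnM.
  by rewrite leq_pexp2l // mulnC leq_divM.
have [|m m_in dvd_m] := @exists_multiple n k (\prod_(p <- ps) p); first by rewrite P_gt0.
exists m => //; rewrite -size_ps uniq_leq_size // => p p_in.
have /andP[p_pr _] := ps_in _ p_in.
rewrite mem_primes p_pr (leq_trans _ (andP m_in).1) //=.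
apply: dvdn_trans dvd_m; rewrite (big_rem p) //=; exact: dvdn_mulr.
Qed.

(** * The resulting lower bound for the end of a run *)

(** The member with few primes up to [k] has as many prime factors as the one with many, so the
    difference is made up of primes above [k >= 2 ^ j]. *)
Lemma omega_run_bound (n k j h s : nat) :
  (forall m, n < m <= n + k -> size (primes m) = size (primes n.+1)) ->
  2 ^ j <= k < 2 ^ j.+1 -> j <= 2 ^ h -> 0 < s <= j ->
  2 ^ (j * (j %/ h.+1 - (j %/ s + s).*2)) <= n + k.
Proof.
move=> run /andP[le_jk lt_kj] le_jh /andP[s_gt0 le_sj].
have k_gt0 : 0 < k by apply: leq_trans le_jk; rewrite expn_gt0.
have le_sk : 2 ^ s <= k.+1.
  by rewrite (leq_trans _ (leqnSn k)) // (leq_trans _ le_jk) // leq_pexp2l.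
have [m1 m1_in large1] := exists_many_primes n le_jk le_jh.
have [m m_in small] := exists_few_small_primes n s_gt0 k_gt0 le_sk lt_kj.
have m_gt0 : 0 < m by case/andP: m_in => /(leq_trans _)->.
apply: leq_trans (andP m_in).2.
apply: leq_trans (expn_count_primes k.+1 m_gt0).
rewrite expnM; apply: (@leq_trans ((2 ^ j) ^ count (leq k.+1) (primes m))); last first.
  by case: (count _ _) => [|c]; rewrite ?expn0 ?leq_exp2r // (leq_trans le_jk).
rewrite leq_pexp2l ?expn_gt0 // leq_subLR.
apply: leq_trans large1 _; rewrite (run _ m1_in) -(run _ m_in).
rewrite -(count_predC (fun p => 1 <= p < k.+1)) leq_add //.
apply/eq_leq/eq_in_count => p; rewrite mem_primes => /and3P[/prime_gt0 p_gt0 _ _] /=.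
by rewrite p_gt0 /= -leqNgt.
Qed.

Lemma run_length_const (n m : nat) : n < m <= n + run_length n ->
  size (primes m) = size (primes n.+1).
Proof.
rewrite /run_length; case: ex_maxnP => k /andP[_ /forallP run] _ /andP[lt_nm le_m].
have lt_i : m - n.+1 < k by lia.
have /eqP := run (Ordinal lt_i); rewrite /= -addSnnS subnKC // addn1.
exact: nptree_of_omega.
Qed.

Lemma run_length_gt0 (n : nat) : 0 < run_length n.
Proof. by rewrite /run_length; case: ex_maxnP => k /andP[]. Qed.

(** The induction starts at the equality [16 ^ 4 = 2 ^ 16]. The bound will make [h ^ 2] of order at
    most [j / h ^ 2]. *)
Lemma expn4_le_exp2 (h : nat) : 16 <= h -> h ^ 4 <= 2 ^ h.
Proof.
elim: h => // h IHh; rewrite leq_eqVlt => /orP[/eqP <-|].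
  by rewrite (_ : 16 = 2 ^ 4) // -expnM leq_pexp2l.
rewrite ltnS => h_ge; rewrite [2 ^ _]expnS; apply: leq_trans (leq_mul (leqnn 2) (IHh h_ge)).
have -> : h.+1 ^ 4 = h ^ 4 + 4 * h ^ 3 + 6 * h ^ 2 + 4 * h + 1.
  by rewrite !expnS expn0; nia.
rewrite !expnS expn0; nia.
Qed.

(** * The bound in terms of real logarithms *)

Local Open Scope ring_scope.

(* [omega_run_bound] with 2^h ~ j = log2 k and s = h^2, so that the loss (j / s + s)
   is O(j / h^2), using j >= h^4 / 4. *)
Lemma run_length_log_bound (R : realType) (n : nat) :
  let j := trunc_log 2 (run_length n) in
  let h := (trunc_log 2 j).+2 in
  (16 <= h)%N ->
  ln 2 * (j%:R ^+ 2 / h%:R) * (1 - 12 / h%:R) <= ln (n%:R : R).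
Proof.
move=> /=; set k := run_length n; set j := trunc_log 2 k; set h := (trunc_log 2 j).+2 => h_ge16.
have k_gt0 : (0 < k)%N := run_length_gt0 n.
have j_gt0 : (0 < j)%N by rewrite lt0n; apply/eqP => j0; move: h_ge16; rewrite /h j0.
have k_bounds : (2 ^ j <= k < 2 ^ j.+1)%N by apply: trunc_log_bounds.
have j_lt : (j < 2 ^ h.-1)%N by exact: (trunc_log_ltn j (ltnSn 1)).
have h4_le : (h ^ 4 <= 4 * j)%N.
  apply: (leq_trans (expn4_le_exp2 h_ge16)).
  by rewrite /h 2!expnS mulnA leq_mul2l trunc_logP.
have s_bounds : (0 < h ^ 2 <= j)%N.
  by move: h4_le; rewrite !expnS expn0; nia.
have := @omega_run_bound n k j h.-1 (h ^ 2) (@run_length_const n)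
  k_bounds (ltnW j_lt) s_bounds.
rewrite prednK //; set e := (_ - _)%N => exp_le.
set a : R := h%:R; set b : R := j%:R.
have a_ge : 16 <= a by rewrite (ler_nat R 16).
have a_gt0 : 0 < a by lra.
have ab : a ^+ 4 <= 4 * b by rewrite -natrX -natrM ler_nat.
have a2_gt0 : 0 < a ^+ 2 by rewrite exprn_gt0.
(* The loss is 11 times [b / a ^+ 2]: 1 for rounding [b / a], 2 for [j %/ h ^ 2], and 8 for
   [2 * a ^+ 2], since [a ^+ 2 <= 4 * (b / a ^+ 2)]. *)
have e_ge : b / a * (1 - 11 / a) <= e%:R.
  have le1 : b / a <= (j %/ h)%:R + 1.
    rewrite natr1 ler_pdivrMr // -natrM ler_nat ltnW //; exact: ltn_ceil.
  have le2 : (j %/ h ^ 2)%:R <= b / a ^+ 2.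
    by rewrite ler_pdivlMr // -natrX -natrM ler_nat leq_divM.
  have le3 : (j %/ h)%:R <= e%:R + 2 * ((j %/ h ^ 2)%:R + a ^+ 2).
    rewrite -natrX -natrD -natrM -natrD ler_nat /e -mul2n; lia.
  have le4 : a ^+ 2 / 4 <= b / a ^+ 2.
    by rewrite ler_pdivlMr // mulrAC ler_pdivrMr // -exprD mulrC mulrC (mulrC b).
  have -> : b / a * (1 - 11 / a) = b / a - 11 * (b / a ^+ 2).
    by field; rewrite gt_eqF.
  have a2_ge : 16 <= a ^+ 2 by nra.
  lra.
have b_ge : a ^+ 2 <= b by rewrite -natrX ler_nat; case/andP: s_bounds.
(* This gives [j * e >= j + 2], so [n + k >= 2 ^ j.+2 > 2 * k], and [n + k] may be replaced by
   [2 * n]. *)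
have e_ge3 : (3 <= e)%N.
  rewrite -(ler_nat R); apply: le_trans e_ge.
  have : 16 <= b / a by rewrite ler_pdivlMr //; nra.
  have : 11 / a <= 11 / 16 by rewrite ler_pM2l // lef_pV2 // posrE.
  by nra.
have le_kn : (k <= n)%N.
  have : (2 ^ j.+2 <= n + k)%N.
    apply: leq_trans exp_le; rewrite leq_pexp2l //; nia.
  by move: k_bounds => /andP[_]; rewrite !expnS; lia.
have n_gt0 : (0 < n)%N by apply: leq_trans le_kn.
have ln2_gt0 : 0 < ln 2 :> R by rewrite ln_gt0 // ltr1n.
have exp_le2 : (2 ^ (j * e) <= 2 * n)%N by apply: leq_trans exp_le _; lia.
have : ln ((2 ^ (j * e))%:R : R) <= ln ((2 * n)%:R : R).
  by rewrite ler_ln ?posrE ?ltr0n ?expn_gt0 ?muln_gt0 // ler_nat.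
rewrite natrX lnXn // natrM lnM ?posrE ?ltr0n // -(mulr_natr (ln 2)) natrM -/b => ln_le.
have : ln 2 * (b * e%:R - 1) <= ln (n%:R : R) by rewrite mulrBr mulr1 lerBlDl.
apply: le_trans; rewrite -mulrA ler_pM2l //.
(* The passage from 11 to 12 frees [(b / a) ^+ 2 >= 1], which absorbs the factor 2 of [2 * n]. *)
have -> : b ^+ 2 / a * (1 - 12 / a) = b * (b / a * (1 - 11 / a)) - (b / a) ^+ 2.
  by field; rewrite gt_eqF.
have b_gt0 : 0 < b by rewrite ltr0n.
apply: lerB; first by rewrite ler_pM2l.
have : 1 <= b / a by rewrite ler_pdivlMr //; nra.
by nra.
Qed.

(** * Asymptotics *)

Lemma near_ln_nat_ge (R : realType) (M : R) : \forall n \near \oo, M <= ln (n%:R : R).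
Proof.
near=> n; rewrite -[M]expRK ler_ln ?posrE ?expR_gt0 //.
  near: n; exact: nbhs_infty_ger.
rewrite ltr0n; near: n; exact: nbhs_infty_gt.
Unshelve. all: by end_near. Qed.

(** The squared form avoids roots. Up to factors close to 1, [ln n] is at least [l * b ^+ 2 / a] and
    its logarithm at least [2 * l * a]; the product is [2 * (l * b) ^+ 2], where [l * b]
    approximates the logarithm of the run length. *)
Lemma sqr_ln_run_length_le (R : realType) (d : R) : 0 < d <= 1 ->
  \forall n \near \oo, ln ((run_length n)%:R : R) ^+ 2 <=
    (2^-1 + d) * (ln n%:R * ln (ln n%:R)).
Proof.
move=> /andP[d_gt0 d_le1]; pose c := d / 4; pose l : R := ln 2.
have c_gt0 : 0 < c by rewrite /c; lra.
have l_gt0 : 0 < l by rewrite ln_gt0 // ltr1n.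
have cl_gt0 : 0 < c * l by rewrite mulr_gt0.
(* From [a >= B] on, [c * l / 2 * a] dominates the constants left over in the lower bound for
   [ln N]. *)
pose B : R := (4 * l - ln l + ln (4 / (c * l))) / (c * l / 2).
have [A [A_ge24 A_gec A_geB]] : exists A : nat,
    [/\ (24 <= A)%N, 12 / c <= A%:R & B <= A%:R].
  exists (maxn 24 (maxn (Num.truncn (12 / c)).+1 (Num.truncn B).+1)).
  split; first exact: leq_maxl.
    apply: le_trans (ltW (truncnS_gt _)) _.
    by rewrite ler_nat !leq_max leqnn orbT.
  apply: le_trans (ltW (truncnS_gt _)) _.
  by rewrite ler_nat !leq_max leqnn !orbT.
pose C : R := ln ((2 ^ 2 ^ A)%:R).
near=> n.
have N_ge : expR 1 <= ln (n%:R : R) by near: n; exact: near_ln_nat_ge.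
have N_geC : 2 * C ^+ 2 <= ln (n%:R : R) by near: n; exact: near_ln_nat_ge.
move: N_ge N_geC; set k := run_length n; set L := ln k%:R; set N := ln n%:R => N_ge N_geC.
have k_gt0 : (0 < k)%N := run_length_gt0 n.
have L_ge0 : 0 <= L by rewrite ln_ge0 // ler1n.
have N_gt0 : 0 < N := lt_le_trans (expR_gt0 1) N_ge.
have lnN_ge1 : 1 <= ln N by rewrite -[leLHS]expRK ler_ln // posrE expR_gt0.
pose j := trunc_log 2 k; pose h := (trunc_log 2 j).+2.
have /andP[le_jk lt_kj] : (2 ^ j <= k < 2 ^ j.+1)%N by apply: trunc_log_bounds.
(* If [h < A] then [k <= 2 ^ 2 ^ A] is bounded, and [2 * C ^+ 2 <= N] suffices. *)
have [lt_hA|le_Ah] := ltnP h A.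
  have L_leC : L <= C.
    rewrite ler_ln ?posrE ?ltr0n ?expn_gt0 // ler_nat.
    apply: leq_trans (ltnW lt_kj) _; rewrite leq_pexp2l //.
    apply: leq_trans (trunc_log_ltn j (ltnSn 1)) _.
    by rewrite leq_pexp2l // ltnW // (ltn_trans _ lt_hA).
  have : L ^+ 2 <= C ^+ 2 by rewrite lerXn2r // nnegrE // (le_trans L_ge0).
  have : 0 <= d * (N * ln N) by rewrite !mulr_ge0 // ltW // (lt_le_trans ltr01).
  have : N <= N * ln N by rewrite ler_peMr // ltW.
  by lra.
have h_ge24 : (24 <= h)%N := leq_trans A_ge24 le_Ah.
have := @run_length_log_bound R n (leq_trans (isT : 16 <= 24)%N h_ge24).
rewrite /= -/k -/j -/h -/N -/l.
set a : R := h%:R; set b : R := j%:R => N_geb.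
have a_ge24 : 24 <= a by rewrite (ler_nat R 24).
have a_gt0 : 0 < a by lra.
have A_le : A%:R <= a by rewrite ler_nat.
have a_gec : 12 / a <= c.
  by rewrite ler_pdivrMr // mulrC -ler_pdivrMr // (le_trans A_gec).
have a_half : 12 / a <= 1 / 2 by rewrite ler_pdivrMr //; lra.
have j_gt0 : (0 < j)%N by rewrite lt0n; apply/eqP => j0; move: h_ge24; rewrite /h j0.
have j_ge : (2 ^ (h - 2) <= j)%N by rewrite /h subn2 /= trunc_logP.
have b_gt0 : 0 < b by rewrite ltr0n.
have b_ge : a <= 4 * b.
  rewrite -natrM ler_nat; apply: leq_trans (leq_mul (leqnn 4) j_ge).
  by rewrite -(expnD 2 2) subnKC // ltnW // ltn_expl.
have lnb_ge : l * (a - 2) <= ln b.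
  have -> : l * (a - 2) = ln ((2 ^ (h - 2))%:R : R).
    by rewrite natrX lnXn // -(mulr_natr (ln 2)) natrB.
  by rewrite ler_ln ?posrE ?ltr0n ?expn_gt0 // ler_nat.
have lnN_ge : l * a * (2 - c) <= ln N.
  have : ln (l * (b ^+ 2 / (2 * a))) <= ln N.
    rewrite ler_ln ?posrE ?mulr_gt0 ?exprn_gt0 ?invr_gt0 ?mulr_gt0 //.
    apply: le_trans N_geb; rewrite invfM mulrA mulrA.
    have -> : l * b ^+ 2 / 2 / a = l * (b ^+ 2 / a) * (1 / 2) by field; rewrite gt_eqF.
    rewrite ler_pM2l; last by rewrite mulr_gt0 // divr_gt0 // exprn_gt0.
    lra.
  rewrite lnM ?posrE ?divr_gt0 ?exprn_gt0 ?mulr_gt0 // ln_div ?posrE ?exprn_gt0 ?mulr_gt0 //.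
  rewrite lnXn // -(mulr_natr (ln b)) => lnN_ge0.
  have -> : l * a * (2 - c) = 2 * (l * (a - 2)) + 4 * l - c * l * a by ring.
  (* ln x < x at x = (c l / 2) a *)
  have ln2a : ln (2 * a) <= c * l / 2 * a + ln (4 / (c * l)).
    have -> : 2 * a = (c * l / 2 * a) * (4 / (c * l)).
      by field; rewrite !gt_eqF.
    have p1 : 0 < c * l / 2 * a by rewrite mulr_gt0 // divr_gt0.
    have p2 : 0 < 4 / (c * l) by rewrite divr_gt0.
    by rewrite lnM ?posrE // lerD2r ltW // ln_sublinear.
  have : 4 * l - ln l + ln (4 / (c * l)) <= c * l / 2 * a.
    by rewrite [leRHS]mulrC -ler_pdivrMr ?divr_gt0 // (le_trans A_geB).
  lra.
have L_le : L <= l * (b + 1).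
  have -> : l * (b + 1) = ln ((2 ^ j.+1)%:R : R).
    by rewrite natrX lnXn // -(mulr_natr (ln 2)) natr1.
  by rewrite ler_ln ?posrE ?ltr0n ?expn_gt0 // ler_nat ltnW.
have L2_le : L ^+ 2 <= (l * b) ^+ 2 * (1 + 3 * c).
  (* From [12 <= c * a] and [a <= 4 * b]. Then [2 * b + 1 <= 3 * b <= 3 * c * b ^+ 2]. *)
  have cb : 1 <= c * b by move: a_gec; rewrite ler_pdivrMr //; nra.
  have : L ^+ 2 <= (l * (b + 1)) ^+ 2.
    by rewrite lerXn2r // nnegrE // mulr_ge0 ?addr_ge0 // ltW.
  move=> /le_trans; apply.
  rewrite exprMn [(l * b) ^+ 2]exprMn -[leRHS]mulrA ler_pM2l ?exprn_gt0 //.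
  rewrite sqrrD1.
  have : b <= c * b ^+ 2 by rewrite expr2 mulrA ler_peMl // ltW.
  have : 1 <= b by rewrite ler1n.
  by lra.
apply: le_trans L2_le _.
have NlnN : (l * b) ^+ 2 * ((1 - c) * (2 - c)) <= N * ln N.
  have -> : (l * b) ^+ 2 * ((1 - c) * (2 - c)) =
      (l * (b ^+ 2 / a) * (1 - c)) * (l * a * (2 - c)).
    by field; rewrite gt_eqF.
  have p : 0 < l * (b ^+ 2 / a) by rewrite mulr_gt0 // divr_gt0 // exprn_gt0.
  have c1 : c <= 1 / 4 by rewrite /c; lra.
  apply: ler_pM => //.
  - by rewrite mulr_ge0 ?(ltW p) //; lra.
  - by rewrite mulr_ge0 ?mulr_ge0 ?ltW //; lra.
  - by apply: le_trans N_geb; rewrite ler_pM2l //; lra.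
have d2 : 0 <= 2^-1 + d by lra.
apply: le_trans (ler_wpM2l d2 NlnN).
rewrite [leRHS]mulrCA ler_pM2l ?exprn_gt0 ?mulr_gt0 //.
(* What remains is [1 + 3 * c <= (1 / 2 + 4 * c) * (1 - c) * (2 - c)], valid for
   [0 < c <= 1 / 4]. *)
by rewrite /c; nra.
Unshelve. all: by end_near. Qed.

Theorem theorem8 (R : realType) :
  exists eps : nat -> R,
    (eps n @[n --> \oo] --> (0 : R)) /\
    (\forall n \near \oo,
      ln ((run_length n)%:R : R) <=
        (1 / Num.sqrt 2 + eps n) * Num.sqrt (ln (n%:R : R) * ln (ln (n%:R : R)))).
Proof.
pose S n := Num.sqrt (ln (n%:R : R) * ln (ln (n%:R : R))).
pose L n := ln ((run_length n)%:R : R).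
have S_gt0 : \forall n \near \oo, 0 < S n.
  near=> n; have N_ge : expR 1 <= ln (n%:R : R) by near: n; exact: near_ln_nat_ge.
  have N_gt0 := lt_le_trans (expR_gt0 1) N_ge.
  rewrite sqrtr_gt0 mulr_gt0 // (lt_le_trans ltr01) //.
  by rewrite -[leLHS]expRK ler_ln // posrE expR_gt0.
(* The least nonnegative error making the inequality true where [S n > 0]; only an upper bound on it
   remains to be shown. *)
exists (fun n => Num.max 0 (L n / S n - 1 / Num.sqrt 2)); split; last first.
  near=> n; rewrite -/(L n) -/(S n) -ler_pdivrMr; last by near: n.
  by rewrite -lerBlDl le_max lexx orbT.
apply/cvgr0Pnorm_le => e e_gt0.
pose d := Num.min e 1.
have d_gt0 : 0 < d by rewrite lt_min e_gt0 ltr01.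
have d_le1 : d <= 1 by rewrite ge_min lexx orbT.
have d_lee : d <= e by rewrite ge_min lexx.
near=> n.
rewrite ger0_norm ?le_max ?lexx // ge_max (ltW e_gt0) /=.
have Sn_gt0 : 0 < S n by near: n.
have L_sqr : L n ^+ 2 <= (2^-1 + d) * (ln n%:R * ln (ln n%:R)).
  by near: n; apply: sqr_ln_run_length_le; rewrite d_gt0.
rewrite lerBlDl ler_pdivrMr //.
have q_gt0 : 0 < Num.sqrt (2 : R) by rewrite sqrtr_gt0.
have p_ge0 : 0 <= 1 / Num.sqrt 2 + e by rewrite addr_ge0 ?divr_ge0 // ltW.
apply: (@le_trans _ _ `|L n|); first exact: ler_norm.
have pS_ge0 : 0 <= (1 / Num.sqrt 2 + e) * S n by rewrite mulr_ge0 // ltW.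
rewrite -ler_sqr ?nnegrE // real_normK ?num_real //.
apply: le_trans L_sqr _.
have prod_ge0 : 0 <= ln n%:R * ln (ln n%:R) :> R by rewrite ltW // -sqrtr_gt0.
rewrite exprMn sqr_sqrtr // ler_wpM2r //.
have q_sqr : (1 / Num.sqrt (2 : R)) ^+ 2 = 2^-1.
  by rewrite div1r exprVn sqr_sqrtr.
(* Used as [(q + e) ^+ 2 >= 1 / 2 + 2 * q * e >= 1 / 2 + e >= 1 / 2 + d]. *)
have q_ge : 1 / 2 <= 1 / Num.sqrt (2 : R).
  rewrite -ler_sqr ?nnegrE ?divr_ge0 // ?ltW // q_sqr; lra.
move: q_sqr q_ge; set q := 1 / Num.sqrt 2 => q_sqr q_ge.
rewrite sqrrD q_sqr; nra.
Unshelve. all: by end_near. Qed.
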